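(* Let $\mathcal{H}$ be the set of all half-spaces in $\mathbb{R}^2$ and let $\mathcal{U}(x)=\{z:\|x-z\|_1\le 1\}$ be the unit ball with respect to the $\ell_1$-norm centred at $x$. Then $\mathcal{H}$ admits $(m,q)$ blackbox query certification under $\mathcal{U}$ for functions $m,q\in O(1/\epsilon^2)$.
   Context: Here $X=\mathbb{R}^2$ and $Y=\{0,1\}$; a half-space is identified with its indicator function $X\to Y$. For a distribution $P$ over $X\times Y$, $P_X$ denotes the marginal of $P$ over $X$, and the robust loss is $\mathcal{L}^{\mathcal{U}}_P(h)=\Pr_{(x,y)\sim P}[\exists z\in\mathcal{U}(x): h(z)\neq y]$. A label query oracle $\mathcal{O}_h$ for a hypothesis $h$ returns $h(x)$ upon querying $x$, for all $x\in X$. A query-based algorithm is an algorithm $\mathcal{A}:(\bigcup_{i=1}^{\infty}X^i,\mathcal{O}_h)\to\mathbb{R}$, that is, it takes a finite sequence $S$ of (unlabeled) domain points, has access to a label query oracle $\mathcal{O}_h$, and outputs a real number $\mathcal{A}(S,\mathcal{O}_h)$. A class $\mathcal{H}$ is certifiable with respect to $\mathcal{U}$ if there exist a query-based algorithm $\mathcal{A}$ and functions $q,m:(0,1)^2\to\mathbb{N}$ such that for every $\epsilon,\delta\in(0,1)$, every distribution $P$ over $X\times Y$, and every $h\in\mathcal{H}$, with probability at least $1-\delta$ over an i.i.d. sample $S\sim P_X^m$ of size $m\ge m(\epsilon,\delta)$ we have $|\mathcal{A}(S,\mathcal{O}_h)-\mathcal{L}^{\mathcal{U}}_P(h)|<\epsilon$,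 with a query budget of $q(\epsilon,\delta)$ for $\mathcal{A}$. In this case $\mathcal{H}$ is said to admit $(m,q)$ blackbox query certification.
   Formalization: The sample is labeled (S ~ P^n, not P_X^n): without labels the claim fails, as point masses at (x,0) and (x,1) share a marginal but can have robust losses 1 and 0. The algorithm is also told its query budget, and the constant in O(1/ε²) may depend on δ. *)

(* Defs.v *)
From HB Require Import structures.
From mathcomp Require Import all_boot all_order all_algebra.
From mathcomp Require Import all_classical all_reals all_analysis.

Set Implicit Arguments.
Unset Strict Implicit.
Unset Printing Implicit Defensive.

Import Order.TTheory GRing.Theory Num.Theory.
Import numFieldNormedType.Exports.

Local Open Scope classical_set_scope.
Local Open Scope ring_scope.

(* The plane, with its Borel sigma-algebra (the product of the two Borel
   sigma-algebras), is [R * R]; the label set {0,1} is [bool]. *)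

Section iid.
Context d (T : measurableType d) (R : realType).

Definition prepend n (z : T * n.-tuple T) : n.+1.-tuple T :=
  [tuple of z.1 :: z.2].

Lemma measurable_prepend n :
  measurable_fun [set: T * n.-tuple T] (@prepend n).
Proof. by apply: measurable_cons; [exact: measurable_fst|exact: measurable_snd]. Qed.

HB.instance Definition _ n :=
  isMeasurableFun.Build _ _ _ _ (@prepend n) (@measurable_prepend n).

(* The n-fold product measure P^n, i.e. the law of an i.i.d. sample of size n,
   by recursion: P^(n+1) is the image of P \x P^n under (x, s) |-> x :: s. *)
Fixpoint iid (P : probability T R) (n : nat) : probability (n.-tuple T) R :=
  match n return probability (n.-tuple T) R with
  | 0%N => @dirac _ (0.-tuple T) [tuple] R
  | n'.+1 => distribution (P \x iid P n')%E (@prepend n')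
  end.

End iid.

Section robust_loss.
Context d (X : measurableType d) (R : realType).

Definition robust_error (U : X -> set X) (h : X -> bool) : set (X * bool) :=
  [set xy | exists2 z, U xy.1 z & h z != xy.2].

Definition robust_loss (U : X -> set X) (P : probability (X * bool)%type R)
  (h : X -> bool) : R := fine (P (robust_error U h)).

End robust_loss.

(* A deterministic adaptive interaction with a label oracle: either stop and
   output a number, or query a point and continue according to the answer. *)
Inductive query_proc (X R : Type) : Type :=
  | Output of R
  | Query of X & (bool -> query_proc X R).

Fixpoint run (X R : Type) (h : X -> bool) (t : query_proc X R) : R :=
  match t with
  | Output r => r
  | Query x k => run h (k (h x))
  end.

Fixpoint nqueries (X R : Type) (h : X -> bool) (t : query_proc X R) : nat :=
  match t with
  | Output _ => 0
  | Query x k => (nqueries h (k (h x))).+1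
  end.

(* A query-based algorithm: [A b S] is its behaviour on the sample S when it is
   run with a budget of b queries.  It knows neither epsilon, delta nor P.
   The budget is a resource of the run and not a constant of the algorithm, as
   the sample may be larger than m(epsilon, delta): an algorithm determined by S
   alone would have to reach every accuracy with a fixed number of queries.
   The sample carries labels because the loss of h depends on the joint law of
   (x, y): two laws with the same marginal over X can have robust losses 0 and
   1, and the oracle answers h(x), not y. *)
Definition query_algorithm (X R : Type) : Type :=
  nat -> seq (X * bool) -> query_proc X R.

Definition respects_budget (X R : Type) (A : query_algorithm X R) : Prop :=
  forall (b : nat) (S : seq (X * bool)) (h : X -> bool),
    (nqueries h (A b S) <= b)%N.

(* H admits (m, q) blackbox query certification under U.  Only the values of m
   and q on (0,1)^2 matter.  The success event is required to be measurable, so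
   that its probability makes sense. *)
Definition admits_certification d (X : measurableType d) (R : realType)
    (H : set (X -> bool)) (U : X -> set X) (m q : R -> R -> nat) : Prop :=
  exists2 A : query_algorithm X R, respects_budget A &
    forall (eps delta : R), 0 < eps < 1 -> 0 < delta < 1 ->
    forall (P : probability (X * bool)%type R) (h : X -> bool), H h ->
    forall n : nat, (m eps delta <= n)%N ->
    let success := [set S : n.-tuple (X * bool)%type |
      `|run h (A (q eps delta) S) - robust_loss U P h| < eps] in
    measurable success /\ ((1 - delta)%:E <= iid P n success)%E.

Section plane.
Context (R : realType).

Definition l1_norm (x : R * R) : R := `|x.1| + `|x.2|.

Definition l1_ball (x : R * R) : set (R * R) := [set z | l1_norm (x - z) <= 1].

(* Closed and open half-spaces are both included. *)
Definition halfspaces : set (R * R -> bool) :=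
  [set h | exists (w : R * R) (b : R), w != 0 /\
    (h = (fun x => b <= w.1 * x.1 + w.2 * x.2) \/
     h = (fun x => b < w.1 * x.1 + w.2 * x.2))].

End plane.

(* f in O(1/eps^2): as eps tends to 0 from the right, for each fixed delta. *)
Definition O_inv_sq (R : realType) (f : R -> R -> nat) : Prop :=
  forall delta : R, 0 < delta < 1 ->
    (fun eps : R => (f eps delta)%:R : R^o) =O_ (0^'+)
      (fun eps : R => 1 / eps ^+ 2 : R^o).

(* Main.v *)
(** For a half-plane h, the l1-ball around x is labelled constantly y as soon as
    its four corners are, so four queries decide whether a sample point (x, y)
    contributes to the robust loss.  The algorithm outputs the empirical mean of
    these contributions over the first b/4 sample points, b being the budget,
    and Chebyshev's inequality gives accuracy eps with probability 1 - delta
    from 1/(delta eps^2) points on. *)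
Require Import Defs.
From mathcomp Require Import all_boot all_order all_algebra.
From mathcomp Require Import all_classical all_reals all_analysis.
From mathcomp Require Import measurable_realfun ring lra.

Set Implicit Arguments.
Unset Strict Implicit.
Unset Printing Implicit Defensive.

Import Order.TTheory GRing.Theory Num.Theory.
Import numFieldNormedType.Exports.

Local Open Scope classical_set_scope.
Local Open Scope ring_scope.

(** * Second moment and Chebyshev bound for the empirical frequency of an event *)

Section empirical_mean.
Context d (T : measurableType d) (R : realType) (P : probability T R).
Variables (E : set T) (mE : measurable E).

Let p : R := fine (P E).

Let PE : P E = p%:E.
Proof. by rewrite /p fineK// fin_num_measure. Qed.

Let PEC : P (~` E) = (1 - p)%:E.
Proof. by rewrite probability_setC// PE. Qed.

Let p01 : 0 <= p <= 1.
Proof. by rewrite -!lee_fin -PE measure_ge0 probability_le1. Qed.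

(** Left unnormalised, so that a point put in front adds one term, in step with the recursion of
    [iid]. The truncation is there because a sample may be longer than the budget can pay for. *)
Definition deviation (k : nat) (s : seq T) : R :=
  \sum_(x <- take k s) (\1_E x - p).

Lemma measurable_deviation k n :
  measurable_fun [set: n.-tuple T] (fun S : n.-tuple T => deviation k S).
Proof.
elim: n k => [|n IHn] [|k].
- rewrite (_ : (fun _ => _) = cst 0); first exact: measurable_cst.
  by apply/funext => S; rewrite /deviation take0 big_nil.
- rewrite (_ : (fun _ => _) = cst 0); first exact: measurable_cst.
  by apply/funext => S; rewrite /deviation tuple0 big_nil.
- rewrite (_ : (fun _ => _) = cst 0); first exact: measurable_cst.
  by apply/funext => S; rewrite /deviation take0 big_nil.
rewrite (_ : (fun _ => _) = (fun S : n.+1.-tuple T =>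
    (\1_E (tnth S ord0) - p) + deviation k [tuple of behead S])).
  apply: measurable_funD.
    apply: measurable_funB; last exact: measurable_cst.
    apply: (measurableT_comp (measurable_indic mE)).
    exact: measurable_tnth.
  apply: (measurableT_comp (IHn k)).
  exact: measurable_behead.
by apply/funext => S; rewrite /deviation {1}(tuple_eta S) /= big_cons.
Qed.

(** The integrand takes one value on [E] and one off [E]. Weighted by [p] and [1 - p] these give
    exactly [c ^+ 2 + a + p * (1 - p)]: the cross term vanishes by centering, and the variance is
    bounded crudely by 1. *)
Lemma integral_centered_sqr (c : R) (a : R) : 0 <= a ->
  (\int[P]_x ((c + (\1_E x - p)) ^+ 2 + a)%:E <= (c ^+ 2 + a + 1)%:E)%E.
Proof.
move=> a0.
have -> : (fun x => ((c + (\1_E x - p)) ^+ 2 + a)%:E) = (fun x =>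
    (((c + 1 - p) ^+ 2 + a)%:E * (\1_E x)%:E +
     ((c - p) ^+ 2 + a)%:E * (\1_(~` E) x)%:E)%E).
  apply/funext => x; rewrite -!EFinM -EFinD; congr EFin.
  rewrite !indicE in_setC; case: (x \in E) => /=; ring.
have b0 (u : R) : 0 <= u ^+ 2 + a by rewrite addr_ge0// sqr_ge0.
have mI (A : set T) : measurable A ->
    measurable_fun [set: T] (fun x => (\1_A x)%:E : \bar R).
  by move=> mA; apply/measurable_EFinP; exact: measurable_indic.
have I0 (A : set T) x : (0 <= ((\1_A x)%:E : \bar R))%E by rewrite lee_fin.
have IA (A : set T) : measurable A -> (\int[P]_x (\1_A x)%:E)%E = P A.
  by move=> mA; rewrite integral_indic// setIT.
have mEC := measurableC mE.
rewrite ge0_integralD//=; first last.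
- by apply: measurable_funeM; exact: mI.
- by move=> x _; rewrite mule_ge0// lee_fin.
- by apply: measurable_funeM; exact: mI.
- by move=> x _; rewrite mule_ge0// lee_fin.
rewrite !ge0_integralZl_EFin//; try exact: mI.
rewrite !IA// PE PEC -!EFinM -EFinD lee_fin.
by have /andP[] := p01; nra.
Qed.

(* The shift [c] makes the induction on the sample go through with
   nonnegative integrands only, hence with Tonelli alone. *)
Lemma integral_deviation_sqr k n (c : R) :
  (\int[iid P n]_S ((c + deviation k S) ^+ 2)%:E <= (c ^+ 2 + k%:R)%:E)%E.
Proof.
have ms m j (a : R) : measurable_fun [set: m.-tuple T]
    (fun S : m.-tuple T => ((a + deviation j S) ^+ 2)%:E).
  apply/measurable_EFinP/measurable_funX/measurable_funD.
    exact: measurable_cst.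
  exact: measurable_deviation.
elim: n k c => [|n IHn] k c.
  rewrite /= integral_dirac//; last exact: ms.
  rewrite diracE mem_set// mul1e lee_fin /deviation big_nil addr0.
  by rewrite lerDl.
case: k => [|k].
  rewrite (_ : (fun _ => _) = cst (c ^+ 2)%:E).
    rewrite integral_cst// [X in (_ * X)%E](_ : _ = 1%E).
      by rewrite mule1 lee_fin addr0.
    exact: probability_setT.
  by apply/funext => S; rewrite /deviation take0 big_nil addr0.
rewrite [iid P _]/= ge0_integral_distribution//; last 2 first.
- exact: ms.
- by move=> S; rewrite lee_fin sqr_ge0.
pose f (z : T * n.-tuple T) : \bar R :=
  ((c + deviation k.+1 (z.1 :: z.2)) ^+ 2)%:E.
have mf : measurable_fun [set: T * n.-tuple T] f.
  by apply: (measurableT_comp (ms _ k.+1 c)); exact: measurable_prepend.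
have f0 z : (0 <= f z)%E by rewrite lee_fin sqr_ge0.
(* Tonelli: integrate over the tail of the sample first, with its first point fixed. *)
rewrite [leLHS](_ : _ = \int[P]_x fubini_F (iid P n) f x)%E; last first.
  exact: (@fubini_tonelli1 _ _ _ _ _ P (iid P n) f mf f0).
apply: (@le_trans _ _
    (\int[P]_x ((c + (\1_E x - p)) ^+ 2 + k%:R)%:E)%E); last first.
  apply: (le_trans (integral_centered_sqr c (ler0n R k))).
  by rewrite lee_fin -natr1 addrA.
apply: ge0_le_integral => //.
- by move=> x _; apply: integral_ge0 => S _; rewrite lee_fin sqr_ge0.
- exact: measurable_fun_fubini_tonelli_F.
- apply/measurable_EFinP/measurable_funD; last exact: measurable_cst.
  apply/measurable_funX/measurable_funD; first exact: measurable_cst.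
  by apply: measurable_funB => //; exact: measurable_indic.
(* The contribution of the first point is absorbed into the shift. *)
move=> x _; apply: le_trans (IHn k (c + (\1_E x - p))).
rewrite le_eqVlt; apply/orP; left; apply/eqP; apply: eq_integral => S _.
by rewrite /f /deviation /= big_cons addrA.
Qed.

(** The second moment of the deviation is at most [k], so it reaches [k * eps] with probability at
    most [k / (k * eps) ^+ 2 = 1 / (k * eps ^+ 2)], which is at most [delta]. *)
Lemma empirical_mean_chebyshev (k n : nat) (eps delta : R) :
  0 < eps -> 0 < delta -> (k <= n)%N -> 1 / (delta * eps ^+ 2) <= k%:R ->
  let close := [set S : n.-tuple T |
    `|(\sum_(x <- take k S) \1_E x) / k%:R - p| < eps] in
  measurable close /\ ((1 - delta)%:E <= iid P n close)%E.
Proof.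
move=> e0 d0 kn kb close.
have de0 : 0 < delta * eps ^+ 2 by rewrite mulr_gt0// exprn_gt0.
have k0 : 0 < k%:R :> R by apply: lt_le_trans kb; rewrite divr_gt0.
have devE (S : n.-tuple T) :
    (`|(\sum_(x <- take k S) \1_E x) / k%:R - p| < eps) =
    (`|deviation k S| < k%:R * eps).
  have -> : (\sum_(x <- take k S) \1_E x) / k%:R - p = deviation k S / k%:R.
    rewrite /deviation sumrB big_const_seq count_predT.
    rewrite size_takel ?size_tuple// iter_addr_0 mulrBl.
    by rewrite -[p *+ k]mulr_natr mulfK// gt_eqF.
  by rewrite normrM normfV (ger0_norm (ltW k0)) ltr_pdivrMr// mulrC.
(* The failure event, squared to fit the Markov inequality [le_integral_abse]. *)
pose far := [set S : n.-tuple T |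
  ((k%:R * eps) ^+ 2)%:E <= `|((deviation k S) ^+ 2)%:E|]%E.
have farE (S : n.-tuple T) : far S = ~~ (`|deviation k S| < k%:R * eps) :> Prop.
  rewrite -leNgt /far /= lee_fin normrX ler_sqr// nnegrE ?normr_ge0//.
  by rewrite mulr_ge0// ltW.
have closeE : close = ~` far.
  apply/seteqP; split => S; rewrite /close /= devE farE; first by move=> ->.
  by move=> /negP; rewrite negbK.
have mdev2 : measurable_fun [set: n.-tuple T]
    (fun S : n.-tuple T => ((deviation k S) ^+ 2)%:E).
  by apply/measurable_EFinP/measurable_funX; exact: measurable_deviation.
have mfar : measurable far.
  rewrite -[far]setTI; apply: emeasurable_fun_c_infty => //.
  exact: measurableT_comp.
rewrite closeE; split; first exact: measurableC.
have ke0 : 0 < (k%:R * eps) ^+ 2 by rewrite exprn_gt0// mulr_gt0.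
have le_k :
    (\int[iid P n]_S `|((deviation k S) ^+ 2)%:E| <= (k%:R)%:E :> \bar R)%E.
  have := integral_deviation_sqr k n 0; rewrite expr0n add0r.
  apply: le_trans; rewrite le_eqVlt; apply/orP; left; apply/eqP.
  apply: eq_integral => S _.
  by rewrite add0r gee0_abs// lee_fin sqr_ge0.
have [q farq] : exists q : R, iid P n far = q%:E.
  by exists (fine (iid P n far)); rewrite fineK// fin_num_measure.
have h : (k%:R * eps) ^+ 2 * q <= k%:R.
  rewrite -lee_fin EFinM -farq.
  apply: le_trans (le_trans _ le_k); last first.
    exact: (le_integral_abse (iid P n) measurableT mdev2 ke0).
  by rewrite setTI.
rewrite probability_setC// farq -EFinB lee_fin.
rewrite lerD2l lerN2.
(* One factor [k] cancels from the Markov bound; what is left is compared with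
   [1 <= k * (delta * eps ^+ 2)]. *)
have : k%:R * (q * (k%:R * eps ^+ 2)) <= k%:R * 1 by lra.
rewrite ler_pM2l// => h2.
move: kb; rewrite ler_pdivrMr// => kb.
have ke2 : 0 < k%:R * eps ^+ 2 by rewrite mulr_gt0// exprn_gt0.
rewrite -(ler_pM2r ke2); lra.
Qed.

End empirical_mean.

(** * Reduction of the robust error to four corners, and the querying procedure *)

Section corners.
Context (R : realType).
Implicit Types (x z w : R * R) (h : R * R -> bool).

(** Hölder duality between the l1 and the sup norm; the bound is the value of the linear form at its
    best corner. *)
Lemma dot_le_max (w1 w2 d1 d2 : R) : `|d1| + `|d2| <= 1 ->
  w1 * d1 + w2 * d2 <= Num.max `|w1| `|w2|.
Proof.
move=> d1d2; set M := Num.max _ _.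
have w1M : `|w1| <= M by rewrite le_max lexx.
have w2M : `|w2| <= M by rewrite le_max lexx orbT.
have h1 : w1 * d1 <= M * `|d1|.
  by rewrite (le_trans (ler_norm _))// normrM ler_wpM2r.
have h2 : w2 * d2 <= M * `|d2|.
  by rewrite (le_trans (ler_norm _))// normrM ler_wpM2r.
apply: (le_trans (lerD h1 h2)).
by rewrite -mulrDr ler_piMr// (le_trans _ w1M).
Qed.

Definition corner_disagrees h (xy : (R * R) * bool) : bool :=
  [|| h (xy.1.1 + 1, xy.1.2) != xy.2, h (xy.1.1 - 1, xy.1.2) != xy.2,
      h (xy.1.1, xy.1.2 + 1) != xy.2 | h (xy.1.1, xy.1.2 - 1) != xy.2].

(* Half-spaces and their complements are convex, and the unit ball is the
   convex hull of its four corners. *)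
Lemma robust_error_corners h : halfspaces h ->
  robust_error (@l1_ball R) h = [set xy | corner_disagrees h xy].
Proof.
move=> hh; apply/seteqP; split => -[[x1 x2] y]; last first.
  rewrite /= /corner_disagrees /robust_error /l1_ball /l1_norm /=.
  case/or4P => hy; [exists (x1 + 1, x2)|exists (x1 - 1, x2)
      |exists (x1, x2 + 1)|exists (x1, x2 - 1)] => //=;
    rewrite ?opprD ?opprK ?addrA ?subrr ?add0r ?normr0 ?normrN ?normr1 ?addr0//.
rewrite /= /corner_disagrees /robust_error /l1_ball /l1_norm /=.
move=> [[z1 z2]] /= zx hz; apply: contraNT hz.
rewrite !negb_or !negbK => /and4P[].
have dzx (w1 w2 : R) := dot_le_max w1 w2 zx.
(* In each case the four corner inequalities say that the margin of the centre dominates both [|w1|]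
   and [|w2|]. The duality bound, for [w] if the label is true and for [- w] if it is false, then
   carries the label to [z]. *)
have [[w1 w2] [b [_ [->|->]]]] := hh => /=; case: y {hh};
  rewrite ?eqb_id ?eqbF_neg -?ltNge -?leNgt => h1 h2 h3 h4.
- have : Num.max `|w1| `|w2| <= w1 * x1 + w2 * x2 - b.
    by rewrite ge_max !ler_norml; apply/andP; split; apply/andP; split; lra.
  by have := dzx w1 w2; lra.
- have : Num.max `|w1| `|w2| < b - (w1 * x1 + w2 * x2).
    by rewrite gt_max !ltr_norml; apply/andP; split; apply/andP; split; lra.
  by have := dzx (- w1) (- w2); rewrite !normrN; lra.
- have : Num.max `|w1| `|w2| < w1 * x1 + w2 * x2 - b.
    by rewrite gt_max !ltr_norml; apply/andP; split; apply/andP; split; lra.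
  by have := dzx w1 w2; lra.
- have : Num.max `|w1| `|w2| <= b - (w1 * x1 + w2 * x2).
    by rewrite ge_max !ler_norml; apply/andP; split; apply/andP; split; lra.
  by have := dzx (- w1) (- w2); rewrite !normrN; lra.
Qed.

Lemma measurable_halfspace h : halfspaces h ->
  measurable_fun [set: R * R] h.
Proof.
have mw (w : R * R) :
    measurable_fun [set: R * R] (fun x : R * R => w.1 * x.1 + w.2 * x.2).
  by apply: measurable_funD; apply: measurable_funM => //;
    exact: measurable_cst.
case=> w [b [_ [->|->]]].
  exact: measurable_fun_ler.
exact: measurable_fun_ltr.
Qed.

Lemma measurable_corner_disagrees h : halfspaces h ->
  measurable [set xy | corner_disagrees h xy].
Proof.
move=> /measurable_halfspace mh.
have mc (a b : R) : measurable_fun [set: (R * R) * bool]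
    (fun xy : (R * R) * bool => h (xy.1.1 + a, xy.1.2 + b) != xy.2).
  rewrite (_ : (fun _ => _) = (fun xy : (R * R) * bool =>
      (h (xy.1.1 + a, xy.1.2 + b) && ~~ xy.2) ||
      (~~ h (xy.1.1 + a, xy.1.2 + b) && xy.2))); last first.
    by apply/funext => xy; case: (h _); case: xy.2.
  have mhab : measurable_fun [set: (R * R) * bool]
      (fun xy : (R * R) * bool => h (xy.1.1 + a, xy.1.2 + b)).
    apply: (measurableT_comp mh); apply/measurable_fun_pairP; split;
      apply: measurable_funD; try exact: measurable_cst;
      exact: measurableT_comp.
  by apply: measurable_or; apply: measurable_and => //; exact: measurable_neg.
have mE : measurable_fun [set: (R * R) * bool] (corner_disagrees h).
  have := measurable_or (mc 1 0) (measurable_or (mc (-1) 0)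
    (measurable_or (mc 0 1) (mc 0 (-1)))).
  by congr measurable_fun; apply/funext => xy;
    rewrite /corner_disagrees !addr0.
by have := mE measurableT [set true] I; rewrite setTI preimage_true.
Qed.

(** The denominator [N] is carried along because the recursion consumes [s]. The queries are
    non-adaptive: the answers only enter the count [acc]. *)
Fixpoint certify (N acc : nat) (s : seq ((R * R) * bool)) :
    query_proc (R * R) R :=
  match s with
  | [::] => Output _ (acc%:R / N%:R)
  | xy :: s' =>
    Query (xy.1.1 + 1, xy.1.2) (fun b1 =>
    Query (xy.1.1 - 1, xy.1.2) (fun b2 =>
    Query (xy.1.1, xy.1.2 + 1) (fun b3 =>
    Query (xy.1.1, xy.1.2 - 1) (fun b4 =>
    certify N (acc + [|| b1 != xy.2, b2 != xy.2, b3 != xy.2 | b4 != xy.2]) s'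
    ))))
  end.

Lemma nqueries_certify h N acc s :
  nqueries h (certify N acc s) = (4 * size s)%N.
Proof. by elim: s acc => //= xy s IHs acc; rewrite IHs mulnS. Qed.

Lemma run_certify h N acc s : run h (certify N acc s) =
  (acc%:R + \sum_(xy <- s) \1_[set xy | corner_disagrees h xy] xy) / N%:R.
Proof.
elim: s acc => [|xy s IHs] acc /=; first by rewrite big_nil addr0.
rewrite IHs big_cons natrD addrA; congr ((_ + _ + _) / _).
by rewrite indicE; congr (_%:R); rewrite mem_setE.
Qed.

End corners.

(** * Sample size, its growth rate, and the certification *)

Definition sample_bound (R : realType) (eps delta : R) : nat :=
  (Num.truncn (1 / (delta * eps ^+ 2))).+1.

Lemma O_inv_sq_sample_bound (R : realType) (c : nat) :
  O_inv_sq (fun eps delta : R => (c * sample_bound eps delta)%N).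
Proof.
move=> delta /andP[d0 d1]; apply/eqO_exP.
(* The summand [1 / delta] pays for the truncated quotient and the summand 1 for the successor, as
   [1 <= 1 / eps ^+ 2] once [eps < 1]. Using [c.+1] keeps the constant positive even for [c = 0]. *)
exists (c.+1%:R * (1 / delta + 1)).
  by rewrite mulr_gt0// addr_gt0// divr_gt0.
have e1 : \forall eps \near (0 : R)^'+, eps < 1.
  exact: nbhs_right_lt.
near=> eps.
have e0 : 0 < eps by near: eps; exact: nbhs_right_gt.
have lt1 : eps < 1 by near: eps.
have e2 : 0 < eps ^+ 2 by rewrite exprn_gt0.
rewrite !ger0_norm ?divr_ge0 ?(ltW e2)// natrM -mulrA.
apply: ler_pM => //; first by rewrite ler_nat.
rewrite /sample_bound -natr1 mulrDl lerD//.
  rewrite !mul1r -invfM -[_^-1]mul1r truncn_le.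
  by rewrite divr_ge0// mulr_ge0// ltW.
by rewrite mul1r ler_pdivlMr// mul1r expr_le1 ?ltW.
Unshelve. all: by end_near. Qed.

Theorem mainTheorem6 (R : realType) :
  exists m q : R -> R -> nat,
    [/\ O_inv_sq m, O_inv_sq q
      & admits_certification (@halfspaces R) (@l1_ball R) m q].
Proof.
exists (@sample_bound R), (fun eps delta => (4 * sample_bound eps delta)%N).
split; last 1 first.
(* Rounding down respects every budget [b]; at [b = 4 * sample_bound eps delta] the division is
   exact, so precisely [sample_bound eps delta] points are used, however long the sample is. *)
- exists (fun b S => certify (b %/ 4) 0 (take (b %/ 4) S)) => [b S h|].
    rewrite nqueries_certify (leq_trans _ (leq_divM b 4))// mulnC leq_mul2r.
    by rewrite size_take_min geq_minl orbT.
  move=> eps delta /andP[e0 _] /andP[d0 _] P h hh n mn success.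
  have := empirical_mean_chebyshev P (measurable_corner_disagrees hh) e0 d0 mn.
  have kb : 1 / (delta * eps ^+ 2) <= (sample_bound eps delta)%:R.
    exact/ltW/truncnS_gt.
  move=> /(_ kb); rewrite (_ : [set _ | _] = success)//.
  apply/seteqP; split => S; rewrite /success /= mulKn// run_certify add0r
    /robust_loss robust_error_corners//.
- have := @O_inv_sq_sample_bound R 1.
  by congr O_inv_sq; apply/funext => eps; apply/funext => delta; rewrite mul1n.
- exact: O_inv_sq_sample_bound.
Qed.
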